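(* Let $m\ge 2$ and $n\ge 1$ be integers, and let $f_0,\dots,f_m\in\mathbb{C}[[1/z]]$ be formal power series in nonnegative powers of $1/z$ with $f_j(\infty)\neq 0$ for all $j=0,\dots,m$, such that the tuple $[f_0,\dots,f_m]$ is in general position (as defined in the context). For each $k=0,\dots,m$ let $Q^{(k)}_0,\dots,Q^{(k)}_m\in\mathbb{C}[z]$ be polynomials with $\deg Q^{(k)}_j\le n-1$ for $j\ne k$, $\deg Q^{(k)}_k\le n$, normalized by $Q^{(k)}_k(0)=1$, such that $$Q^{(k)}_k f_k+\sum_{j\neq k} zQ^{(k)}_j f_j=O\!\left(\frac1{z^{mn}}\right),\qquad z\to\infty .$$ For each $s=0,\dots,m$ let $P^{(s)}_0,\dots,P^{(s)}_m\in\mathbb{C}[z]$ be polynomials with $\deg P^{(s)}_j\le mn-1$ for $j\neq s$, $\deg P^{(s)}_s\le mn$, normalized by $P^{(s)}_s(0)=1$, such that $$z f_s P^{(s)}_j-f_jP^{(s)}_s=O\!\left(\frac1{z^{n}}\right),\qquad z\to\infty,\qquad j=0,\dots,m,\ j\neq s .$$ Let $M_1(z)$ be the $(m+1)\times(m+1)$ polynomial matrix whose $k$-th row, $k=0,\dots,m$, is $$\bigl(zQ^{(k)}_0,\dots,zQ^{(k)}_{k-1},\,Q^{(k)}_k,\,zQ^{(k)}_{k+1},\dots,zQ^{(k)}_m\bigr),$$ and let $M_2(z)$ be the $(m+1)\times(m+1)$ polynomial matrix whose $s$-th column, $s=0,\dots,m$, is the transpose of $$\bigl(zP^{(s)}_0,\dots,zP^{(s)}_{s-1},\,P^{(s)}_s,\,zP^{(s)}_{s+1},\dots,zP^{(s)}_m\bigr).$$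 Then $M_1(z)M_2(z)\equiv I_{m+1}$, where $I_{m+1}$ is the identity $(m+1)\times(m+1)$ matrix.
   Context: All relations are understood formally, in the field $\mathbb{C}((1/z))$ of formal Laurent series in $1/z$: $g=O(1/z^{N})$ as $z\to\infty$ means that the coefficients of $z^{i}$ in $g$ vanish for all $i>-N$. The value $f_j(\infty)$ is the constant term of $f_j$. The zero polynomial satisfies every degree bound. General position: the tuple $[f_0,\dots,f_m]$ is in general position if all multi-indexes are normal for the Hermite--Padé polynomials associated with the tuple at infinity, in the following sense. (i) (Type I) For every multi-index $(n_0,\dots,n_m)$ of nonnegative integers, the only polynomials $Q_0,\dots,Q_m\in\mathbb{C}[z]$ with $\deg Q_j\le n_j$ for all $j$ and $$\sum_{j=0}^m Q_jf_j=O\bigl(z^{-(\sum_{j}(n_j+1)-\max_j n_j)}\bigr)$$ are $Q_0=\dots=Q_m=0$. In particular, for the multi-index $(n-1,\dots,n-1)$ the order on the right-hand side is $O(1/z^{mn+1})$. (ii) (Type II) For every $n\ge1$ (multi-index $(mn-1,\dots,mn-1)$) and every $s\in\{0,\dots,m\}$, the only polynomials $P_0,\dots,P_m\in\mathbb{C}[z]$ with $\deg P_j\le mn-1$ for all $j$ and $f_sP_j-f_jP_s=O(1/z^{n+1})$ for all $j\ne s$ are $P_0=\dots=P_m=0$. Under general position, polynomials $Q^{(k)}_j$ and $P^{(s)}_j$ with the properties required in the claim, including the normalizations at $z=0$, exist for every $n\ge1$; the $Q^{(k)}_j$ are generated by type I and the $P^{(s)}_j$ by type II Hermite--Padé polynomials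 of the tuple. *)

(* Defs.v *)
From HB Require Import structures.
From mathcomp Require Import all_boot all_order all_algebra.
From mathcomp Require Export complex.
From mathcomp Require Export reals.

Set Implicit Arguments.
Unset Strict Implicit.
Unset Printing Implicit Defensive.

Import Order.TTheory GRing.Theory Num.Theory.
Local Open Scope ring_scope.

Section Laurent.
Variable C : fieldType.

(* An element g of C((1/z)) is represented by the function sending i : int to
   the coefficient of z^i in g.  Every series formed below from power series in
   1/z and polynomials in z vanishes at all large i, so it lies in C((1/z)). *)
Definition lseries := int -> C.

(* f : nat -> C stands for the sum of the f i * z^(-i); f 0 is f(oo). *)
Definition lseries_of (f : nat -> C) : lseries :=
  fun i => if i <= 0 then f `|i|%N else 0.

(* The Cauchy product in C((1/z)) with a polynomial factor: the coefficient of
   z^i in p * g is the finite sum of the p_l * g_(i - l). *)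
Definition lmulp (p : {poly C}) (g : lseries) : lseries :=
  fun i => \sum_(l < size p) p`_l * g (i - l%:Z).

Definition lsum (I : finType) (A : pred I) (g : I -> lseries) : lseries :=
  fun i => \sum_(j | A j) g j i.

Definition ladd (g h : lseries) : lseries := fun i => g i + h i.

Definition lsub (g h : lseries) : lseries := fun i => g i - h i.

(* g = O(1/z^N) as z -> oo *)
Definition bigO_infty (g : lseries) (N : nat) : Prop :=
  forall i : int, - N%:Z < i -> g i = 0.

(* The zero polynomial has size 0, so it satisfies every degree bound. *)
Definition deg_le (p : {poly C}) (d : nat) : Prop := (size p <= d.+1)%N.

Definition typeI_normal (m : nat) (f : 'I_m.+1 -> nat -> C) : Prop :=
  forall (nu : 'I_m.+1 -> nat) (Q : 'I_m.+1 -> {poly C}),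
    (forall j, deg_le (Q j) (nu j)) ->
    bigO_infty (lsum xpredT (fun j => lmulp (Q j) (lseries_of (f j))))
      (\sum_(j < m.+1) (nu j).+1 - \max_(j < m.+1) nu j)%N ->
    forall j, Q j = 0.

Definition typeII_normal (m : nat) (f : 'I_m.+1 -> nat -> C) : Prop :=
  forall (n : nat) (s : 'I_m.+1) (P : 'I_m.+1 -> {poly C}),
    (1 <= n)%N ->
    (forall j, deg_le (P j) (m * n - 1)%N) ->
    (forall j, j != s ->
       bigO_infty (lsub (lmulp (P j) (lseries_of (f s)))
                        (lmulp (P s) (lseries_of (f j)))) n.+1) ->
    forall j, P j = 0.

Definition general_position (m : nat) (f : 'I_m.+1 -> nat -> C) : Prop :=
  typeI_normal f /\ typeII_normal f.

Definition M1 (m : nat) (Q : 'I_m.+1 -> 'I_m.+1 -> {poly C}) :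
    'M[{poly C}]_(m.+1) :=
  \matrix_(k, j) (if j == k then Q k k else 'X * Q k j).

Definition M2 (m : nat) (P : 'I_m.+1 -> 'I_m.+1 -> {poly C}) :
    'M[{poly C}]_(m.+1) :=
  \matrix_(j, s) (if j == s then P s s else 'X * P s j).

End Laurent.

(* Main.v *)
Require Import Defs.
From mathcomp Require Import all_boot all_order all_algebra.
From mathcomp Require Import zify.

Set Implicit Arguments.
Unset Strict Implicit.
Unset Printing Implicit Defensive.

Import Order.TTheory GRing.Theory Num.Theory.
Local Open Scope ring_scope.


(** Why the product is the identity.  Write [a k j] for the entries of [M1 Q] and
    [b j s] for those of [M2 P].  The factors ['X] off the diagonals only
    serve to bring the two hypotheses to a homogeneous form:
    - row [k] of [M1 Q] has degree at most [n], and
      [\sum_j a k j * f j = O(1/z^(mn))];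
    - column [s] of [M2 P] has degree at most [mn], and
      [b j s * f s - b s s * f j = O(1/z^n)] for every [j], trivially if [j = s].
    Replacing each [b j s * f s] by [b s s * f j] plus its remainder,
    [(\sum_j a k j * b j s) * f s = b s s * (\sum_j a k j * f j)
         + \sum_j a k j * (b j s * f s - b s s * f j)],
    and in each summand the degree of the polynomial factor is absorbed exactly
    by the order of vanishing, so the whole is [O(1)].  As [f s] has a nonzero
    value at infinity, the entry [\sum_j a k j * b j s] of the product is a
    constant ([size_pairing_le1]).  That constant is read off at [z = 0], where
    the off-diagonal factors ['X] vanish and the normalizations make both
    matrices the identity. *)

Section LaurentAction.
Variable C : fieldType.
Implicit Types (p q : {poly C}) (g h : lseries C).

Lemma lmulp_widen p g (N : nat) i : (size p <= N)%N ->
  lmulp p g i = \sum_(l < N) p`_l * g (i - l%:Z).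
Proof.
move=> leN; rewrite /lmulp (big_ord_widen N (fun l : nat => p`_l * g (i - l%:Z))) //.
rewrite big_mkcond; apply: eq_bigr => l _; case: ltnP => // le_p_l.
by rewrite nth_default ?mul0r.
Qed.

Lemma lmulp0l g i : lmulp 0 g i = 0.
Proof. by rewrite /lmulp size_poly0 big_ord0. Qed.

Lemma lmulpDl p q g i : lmulp (p + q) g i = lmulp p g i + lmulp q g i.
Proof.
rewrite (lmulp_widen _ _ (size_polyD p q)).
rewrite (lmulp_widen _ _ (leq_maxl (size p) (size q))).
rewrite (lmulp_widen _ _ (leq_maxr (size p) (size q))) -big_split /=.
by apply: eq_bigr => l _; rewrite coefD mulrDl.
Qed.

Lemma lmulp_suml (I : finType) (p : I -> {poly C}) g i :
  lmulp (\sum_j p j) g i = \sum_j lmulp (p j) g i.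
Proof.
apply: (big_morph (fun q => lmulp q g i)); last exact: lmulp0l.
by move=> q r; apply: lmulpDl.
Qed.

Lemma lmulp_sub p g h i : lmulp p (lsub g h) i = lmulp p g i - lmulp p h i.
Proof. by rewrite /lmulp -sumrB; apply: eq_bigr => l _; rewrite mulrBr. Qed.

Lemma lmulp_lsum (I : finType) (A : pred I) p (g : I -> lseries C) i :
  lmulp p (lsum A g) i = \sum_(j | A j) lmulp p (g j) i.
Proof.
rewrite /lmulp exchange_big /=.
by apply: eq_bigr => l _; rewrite /lsum mulr_sumr.
Qed.

(** One step of Horner's scheme: multiplication by [z] shifts the
    coefficients of a series, so [p * 'X + c%:P] acts through [p] and [c]. *)
Lemma lmulp_MXaddC p (c : C) g i :
  lmulp (p * 'X + c%:P) g i = lmulp p g (i - 1) + c * g i.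
Proof.
have le_size : (size (p * 'X + c%:P)%R <= (size p).+1)%N.
  by rewrite size_MXaddC; case: ifP.
rewrite (lmulp_widen _ _ le_size) big_ord_recl addrC /=; congr (_ + _).
  apply: eq_bigr => l _; rewrite coefD coefMX coefC /= addr0.
  by rewrite /bump /= add1n -add1n PoszD opprD addrA.
by rewrite coefD coefMX coefC /= add0r subr0.
Qed.

Lemma lmulpA p q g i : lmulp (p * q) g i = lmulp p (lmulp q g) i.
Proof.
elim/poly_ind: p i => [|p c IHp] i; first by rewrite mul0r !lmulp0l.
rewrite lmulp_MXaddC -IHp mulrDl lmulpDl -mulrA ['X * q]mulrC mulrA.
rewrite -[p * q * 'X]addr0 -[0]/(0%:P) lmulp_MXaddC mul0r addr0; congr (_ + _).
rewrite mul_polyC (@lmulp_widen _ _ (size q)) ?size_scale_leq // /lmulp mulr_sumr.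
by apply: eq_bigr => l _; rewrite coefZ mulrA.
Qed.

Lemma lmulpCA p q g i : lmulp p (lmulp q g) i = lmulp q (lmulp p g) i.
Proof. by rewrite -!lmulpA mulrC. Qed.

Lemma bigO_lmulp p g (d N : nat) :
  deg_le p d -> bigO_infty g (d + N) -> bigO_infty (lmulp p g) N.
Proof.
move=> deg_p Og i lt_i; rewrite /lmulp big1 // => l _; rewrite Og ?mulr0 //.
have le_l : (l <= d)%N by rewrite -ltnS (leq_trans (ltn_ord l) deg_p).
by lia.
Qed.

(** The coefficient of [z^(deg p)] in [p * f] is [lead_coef p * f 0]: a factor
    with a nonzero value at infinity does not lower the degree. *)
Lemma bigO0_lmulp_size p (f : nat -> C) :
  f 0%N != 0 -> bigO_infty (lmulp p (lseries_of f)) 0 -> (size p <= 1)%N.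
Proof.
move=> f0_neq0 Opf; rewrite leqNgt; apply/negP => size_p.
have size_pE : size p = (size p).-1.+1 by rewrite prednK // ltnW.
have deg_gt0 : - 0%:Z < (size p).-1%:Z by rewrite oppr0 ltz_nat -ltnS -size_pE.
have /eqP := Opf _ deg_gt0.
rewrite (@lmulp_widen _ _ (size p).-1.+1); last by rewrite -size_pE.
rewrite big_ord_recr /= big1 => [|l _].
  rewrite add0r subrr /lseries_of lexx mulf_eq0 (negPf f0_neq0) orbF.
  by rewrite -lead_coefE lead_coef_eq0 -size_poly_eq0 size_pE.
by rewrite /lseries_of subr_le0 lez_nat leqNgt ltn_ord mulr0.
Qed.

(** A type I vector [a] paired with a type II vector [b]: the degree of [a] is
    the order of the type II remainders, and the degree of [b s] is the order
    of the type I remainder, so both remainders contribute only [O(1)]. *)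
Lemma size_pairing_le1 (I : finType) (f : I -> nat -> C) (a b : I -> {poly C})
    (s : I) (d e : nat) :
  f s 0%N != 0 ->
  (forall j, deg_le (a j) d) -> deg_le (b s) e ->
  bigO_infty (lsum xpredT (fun j => lmulp (a j) (lseries_of (f j)))) e ->
  (forall j, bigO_infty (lsub (lmulp (b j) (lseries_of (f s)))
                              (lmulp (b s) (lseries_of (f j)))) d) ->
  (size (\sum_j a j * b j)%R <= 1)%N.
Proof.
move=> fs0 deg_a deg_bs Oa Ob; apply: (bigO0_lmulp_size fs0) => i lt_i.
have -> : lmulp (\sum_j a j * b j) (lseries_of (f s)) i
    = lmulp (b s) (lsum xpredT (fun j => lmulp (a j) (lseries_of (f j)))) i
      + \sum_j lmulp (a j) (lsub (lmulp (b j) (lseries_of (f s)))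
                                  (lmulp (b s) (lseries_of (f j)))) i.
  rewrite lmulp_suml lmulp_lsum -big_split; apply: eq_bigr => j _ /=.
  by rewrite lmulp_sub lmulpCA addrC subrK lmulpA.
rewrite (bigO_lmulp (N := 0) deg_bs) ?addn0 // add0r big1 // => j _.
by rewrite (bigO_lmulp (N := 0) (deg_a j)) // addn0.
Qed.

End LaurentAction.

Lemma deg_le_mulX (C : fieldType) (p : {poly C}) (d : nat) :
  (0 < d)%N -> deg_le p (d - 1) -> deg_le ('X * p) d.
Proof.
rewrite /deg_le => d_gt0 deg_p; apply: leq_trans (size_polyMleq _ _) _.
by rewrite size_polyX; lia.
Qed.

(* Q k j is Q^{(k)}_j and P s j is P^{(s)}_j. *)
Theorem theorem1 (R : realType) (m n : nat) (hm : (2 <= m)%N) (hn : (1 <= n)%N)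
    (f : 'I_m.+1 -> nat -> R[i])
    (hf : forall j, f j 0%N != 0)
    (hgp : general_position f)
    (Q : 'I_m.+1 -> 'I_m.+1 -> {poly R[i]})
    (hQdeg : forall k j, j != k -> deg_le (Q k j) (n - 1)%N)
    (hQdegk : forall k, deg_le (Q k k) n)
    (hQ0 : forall k, (Q k k).[0] = 1)
    (hQ : forall k,
       bigO_infty
         (ladd (lmulp (Q k k) (lseries_of (f k)))
               (lsum (fun j => j != k)
                     (fun j => lmulp ('X * Q k j) (lseries_of (f j)))))
         (m * n)%N)
    (P : 'I_m.+1 -> 'I_m.+1 -> {poly R[i]})
    (hPdeg : forall s j, j != s -> deg_le (P s j) (m * n - 1)%N)
    (hPdegs : forall s, deg_le (P s s) (m * n)%N)
    (hP0 : forall s, (P s s).[0] = 1)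
    (hP : forall s j, j != s ->
       bigO_infty
         (lsub (lmulp ('X * P s j) (lseries_of (f s)))
               (lmulp (P s s) (lseries_of (f j))))
         n) :
  M1 Q *m M2 P = 1%:M.
Proof.
have degM1 k j : deg_le (M1 Q k j) n.
  by rewrite mxE; case: eqVneq => [_ // | ?]; apply: deg_le_mulX; auto.
have degM2 j s : deg_le (M2 P j s) (m * n).
  rewrite mxE; case: eqVneq => [_ // | ?]; apply: deg_le_mulX; auto.
  by rewrite muln_gt0 hn; lia.
have row_bigO k : bigO_infty
    (lsum xpredT (fun j => lmulp (M1 Q k j) (lseries_of (f j)))) (m * n).
  move=> i lt_i; rewrite -(hQ k i lt_i) /lsum /ladd (bigD1 k) //= mxE eqxx.
  by congr (_ + _); apply: eq_bigr => j /negPf neq_jk; rewrite mxE neq_jk.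
have col_bigO s j : bigO_infty
    (lsub (lmulp (M2 P j s) (lseries_of (f s)))
          (lmulp (M2 P s s) (lseries_of (f j)))) n.
  case: (eqVneq j s) => [-> i _ | neq_js]; first by rewrite /lsub subrr.
  by rewrite !mxE eqxx (negPf neq_js); apply: hP.
have M1_at0 k j : (M1 Q k j).[0] = (j == k)%:R.
  by rewrite mxE; case: eqVneq => _; rewrite ?hQ0 // hornerM hornerX mul0r.
have M2_at0 j s : (M2 P j s).[0] = (j == s)%:R.
  by rewrite mxE; case: eqVneq => _; rewrite ?hP0 // hornerM hornerX mul0r.
apply/matrixP => k s.
have entry_const : (size ((M1 Q *m M2 P) k s) <= 1)%N.
  by rewrite mxE; apply: size_pairing_le1 (row_bigO k) (col_bigO s).
have entry_at0 : ((M1 Q *m M2 P) k s).[0] = (k == s)%:R.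
  rewrite mxE horner_sum (bigD1 k) //= big1 => [|j /negPf neq_jk].
    by rewrite hornerM M1_at0 M2_at0 eqxx mul1r addr0.
  by rewrite hornerM M1_at0 neq_jk mul0r.
rewrite (size1_polyC entry_const) -horner_coef0 entry_at0 mxE.
by case: (k == s).
Qed.
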